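(* Let $S$ be a semigroup and $s$ a PE solution on $S$ defined by $s(a,b)=(ab,\theta_a(b))$. Then the map $s$ is a QYBE solution if and only if the following conditions are satisfied for all $a,b,c\in S$: (Y1) $abc=a\,\theta_b(c)\,bc$; (Y2) $\theta_a\theta_b=\theta_b$; (Y3) $\theta_a(bc)=\theta_{\theta_b(c)}(bc)$.
   Context: For a map $s:S\times S\to S\times S$ put $s_{12}=s\times \mathrm{id}_S$, $s_{23}=\mathrm{id}_S\times s$, $s_{13}=(\mathrm{id}_S\times\tau)s_{12}(\mathrm{id}_S\times\tau)$ with $\tau(x,y)=(y,x)$; juxtaposition of maps is composition, rightmost map applied first. The map $s$ is a PE solution (solution of the pentagon equation) if $s_{23}s_{13}s_{12}=s_{12}s_{23}$, and a QYBE solution (solution of the quantum Yang-Baxter equation) if $s_{23}s_{13}s_{12}=s_{12}s_{13}s_{23}$. In $s(a,b)=(ab,\theta_a(b))$, $ab$ is the product of the semigroup $S$ and $\theta_a:S\to S$ is a map for each $a\in S$. *)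

(* Defs.v *)
From mathcomp Require Import all_boot.

Set Implicit Arguments.
Unset Strict Implicit.
Unset Printing Implicit Defensive.

(* Plain MathComp; S^3 is represented as (S * S) * S. *)

Definition leg12 (S : Type) (s : S * S -> S * S) (t : S * S * S) : S * S * S :=
  (s t.1, t.2).

Definition leg23 (S : Type) (s : S * S -> S * S) (t : S * S * S) : S * S * S :=
  let: (x, y, z) := t in (x, (s (y, z)).1, (s (y, z)).2).

Definition flip (S : Type) (p : S * S) : S * S := (p.2, p.1).

(* leg23 (@flip S) is id x tau. *)
Definition leg13 (S : Type) (s : S * S -> S * S) : S * S * S -> S * S * S :=
  leg23 (@flip S) \o leg12 s \o leg23 (@flip S).

Definition pe_solution (S : Type) (s : S * S -> S * S) : Prop :=
  leg23 s \o leg13 s \o leg12 s =1 leg12 s \o leg23 s.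

Definition qybe_solution (S : Type) (s : S * S -> S * S) : Prop :=
  leg23 s \o leg13 s \o leg12 s =1 leg12 s \o leg13 s \o leg23 s.

(* Main.v *)
Require Import Defs.
From mathcomp Require Import all_boot.

(** Evaluate both equations at (a, b, c).  For a pentagon solution the common
    left-hand side of the two equations equals
    (abc, theta_a(bc), theta_b(c)), whereas the right-hand side of the
    Yang-Baxter equation is
    (a theta_b(c) bc, theta_(a theta_b(c))(bc), theta_a theta_b(c)).
    The first and third components give the first two conditions; the second
    one is the last condition with theta_(a theta_b(c)) in place of
    theta_(theta_b(c)).  These two maps agree once theta_x theta_y = theta_y
    holds for all x, y: the third component of the pentagon equation says that
    theta_(theta_a(b)) theta_(ab) = theta_b, whose left-hand side then
    collapses to theta_(ab), so theta_(ab) = theta_b. *)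

Local Open Scope group_scope.

Section PentagonSolution.

Variables (S : magmaType) (theta : S -> S -> S) (s : S * S -> S * S).
Hypothesis s_def : forall a b : S, s (a, b) = (a * b, theta a b).
Hypothesis s_pe : pe_solution s.

Lemma pe_theta_comp a b c : theta (theta a b) (theta (a * b) c) = theta b c.
Proof.
by have := s_pe (a, b, c); rewrite /leg13 /leg12 /flip /= !s_def /= !s_def => -[].
Qed.

(** The pentagon equation replaces the left-hand side of the Yang-Baxter
    equation by the simpler composite of the 23 leg followed by the 12 leg. *)
Lemma pe_qybeP :
  qybe_solution s <->
  forall a b c : S,
    [/\ a * (b * c) = a * theta b c * (b * c),
        theta a (b * c) = theta (a * theta b c) (b * c)
      & theta b c = theta a (theta b c)].
Proof.
split=> [ybe a b c | eqs [[a b] c]].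
  have := ybe (a, b, c); rewrite s_pe.
  by rewrite /leg13 /leg12 /flip /= !s_def /= => -[].
rewrite s_pe /leg13 /leg12 /flip /= !s_def /=.
by have [<- <- <-] := eqs a b c.
Qed.

Lemma pe_theta_mul :
  (forall a b : S, theta a \o theta b =1 theta b) ->
  forall a b : S, theta (a * b) =1 theta b.
Proof. by move=> theta_theta a b c; rewrite -[RHS](pe_theta_comp a) [RHS]theta_theta. Qed.

End PentagonSolution.

Theorem proposition7 (S : magmaType) (mulA : @associative S *%g)
    (theta : S -> S -> S) (s : S * S -> S * S)
    (s_def : forall a b : S, s (a, b) = (a * b, theta a b))
    (s_pe : pe_solution s) :
  qybe_solution s <->
  [/\ forall a b c : S, a * b * c = a * theta b c * b * c,
      forall a b : S, theta a \o theta b =1 theta b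
    & forall a b c : S, theta a (b * c) = theta (theta b c) (b * c)].
Proof.
have thetaM := pe_theta_mul _ _ _ s_def s_pe.
apply: (iff_trans (pe_qybeP _ _ _ s_def s_pe)); split=> [eqs | [Y1 Y2 Y3] a b c].
  have Y2 a b : theta a \o theta b =1 theta b.
    by move=> c /=; have [_ _ <-] := eqs a b c.
  split=> // a b c; have [eq1 eq2 _] := eqs a b c.
    by rewrite -!mulA eq1 -!mulA.
  by rewrite eq2 thetaM.
split; first by rewrite !mulA Y1.
  by rewrite thetaM.
by rewrite [RHS]Y2.
Qed.
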